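(* Let $\mathcal{M} = S^1$, let $\mathcal{X} = \mathbb{R}^n$, and let $g : \mathcal{M} \to \mathcal{X}$ be a homeomorphism onto its image $\mathcal{M}_x = g(\mathcal{M})$. Let $(f_{\phi(t)})_{t \in [0,1]}$ be a family of maps $f_{\phi(t)} : \mathcal{X} \to S^1$ that is continuous in $t$, i.e. for every $m \in \mathcal{M}$ the map $[0,1] \to S^1$, $t \mapsto f_{\phi(t)}(g(m))$, is continuous. Assume that $f_{\phi(t)} \circ g : \mathcal{M} \to S^1$ is injective for every $t \in [0,1]$. Then: (1) For every $k \ge 1$ and every $k$ distinct points $m_1, \dots, m_k \in \mathcal{M}$, the cyclic ordering on $S^1$ of the points $f_{\phi(0)}(g(m_1)), \dots, f_{\phi(0)}(g(m_k))$ is equal to the cyclic ordering on $S^1$ of the points $f_{\phi(1)}(g(m_1)), \dots, f_{\phi(1)}(g(m_k))$ (as orderings of the indices $1,\dots,k$). (2) Consequently, a figure 8 embedding cannot be transformed into a homeomorphic embedding: let $m_1, m_2, m_3, m_4 \in \mathcal{M}$ be four distinct points appearing in this cyclic order on $\mathcal{M} = S^1$, and write $z_i(t) = f_{\phi(t)}(g(m_i))$. If $f_{\phi(t)} \circ g$ is a homeomorphism $\mathcal{M} \to S^1$, then the cyclic order of the points $z_i(t)$ is $(z_1,z_2,z_3,z_4) \bmod C_4$ or $(z_4,z_3,z_2,z_1) \bmod C_4$; hence if the cyclic order of the points $z_i(0)$ is $(z_1,z_2,z_4,z_3) \bmod C_4$ (the cyclic order of a figure 8 embedding), then $f_{\phi(1)}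 \circ g$ is not a homeomorphism from $\mathcal{M}$ to $S^1$.
   Context: The circle is $S^1 \subset \mathbb{R}^2$ (identified with $\mathrm{SO}(2)$). For $k$ distinct points $z_1,\dots,z_k \in S^1$ indexed by $1,\dots,k$, their cyclic ordering is the order in which the indices are encountered when traversing $S^1$ once counterclockwise; it is well-defined only up to cyclic rotation, i.e. it is an element of the set of orderings of $\{1,\dots,k\}$ modulo the cyclic group $C_k$ acting by cyclic shifts. The notation $(z_{i_1},\dots,z_{i_k}) \bmod C_k$ denotes the cyclic ordering in which one encounters $z_{i_1}$, then $z_{i_2}$, ..., then $z_{i_k}$, and then returns to $z_{i_1}$. The maps $f_{\phi(t)}$ model an encoder whose parameters $\phi(t)$ evolve by continuous-time optimization from initialization ($t=0$) to the end of training ($t=1$). For fixed $t$ the map $f_{\phi(t)} \circ g$ is not assumed to be continuous on $\mathcal{M}$. A figure 8 embedding is one in which the image of $\mathcal{M}$ consists of two disjoint arcs whose four end points $z_1, z_2, z_3, z_4$ (corresponding to points of $\mathcal{M}$ in cyclic order) have cyclic order $(z_1,z_2,z_4,z_3) \bmod C_4$ on $S^1$. *)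

(* Defs.v *)
From mathcomp Require Import all_boot all_order all_algebra.
From mathcomp Require Import all_classical all_reals all_analysis.
Import Order.TTheory GRing.Theory Num.Theory.
Import numFieldNormedType.Exports.

Set Implicit Arguments.
Unset Strict Implicit.
Unset Printing Implicit Defensive.

Local Open Scope classical_set_scope.
Local Open Scope ring_scope.

(* As a type (through the coercion set_type), it carries the subspace
   topology. *)
Definition circle (R : realType) : set (R * R)%type :=
  [set z | z.1 ^+ 2 + z.2 ^+ 2 = 1].
Arguments circle : clear implicits.

Definition homeomorphism (S T : topologicalType) (f : S -> T) : Prop :=
  continuous f /\
  exists h : T -> S, [/\ continuous h, cancel f h & cancel h f].

Definition homeomorphism_onto_image (S T : topologicalType) (f : S -> T) :
    Prop :=
  continuous f /\
  exists h : T -> S, cancel f h /\ {within range f, continuous h}.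

Section CyclicOrder.
Variable R : realType.

Definition angle (z : circle R) : R :=
  let: (x, y) := set_val z in
  if 0 <= y then acos x else 2 * pi - acos x.

(* This characterizes [angle z] as the instant of [0, 2 pi[ at which z is met
   when traversing the circle once counterclockwise from (1, 0). *)
Lemma angleP (z : circle R) :
  0 <= angle z < 2 * pi /\ set_val z = (cos (angle z), sin (angle z)).
Proof.
case: z => -[x y] /= xy; rewrite /angle.
have /= e := set_mem xy; rewrite set_valE /=.
have x1 : -1 <= x <= 1.
  by rewrite -ler_norml -(@expr_le1 _ 2)// real_normK ?num_real// -e lerDl sqr_ge0.
have py : 1 - x ^+ 2 = y ^+ 2 by rewrite -e addrC addKr.
have [a0 api] : 0 <= acos x /\ acos x <= pi by rewrite acos_ge0// acos_lepi.
have ca : cos (acos x) = x by rewrite acosK// in_itv.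
have sa : sin (acos x) = `|y| by rewrite sin_acos// py sqrtr_sqr.
have pi0 := pi_gt0 R.
case: ifPn => [y0|]; last rewrite -ltNge => y0; split.
- by rewrite a0 (le_lt_trans api)// mulr_natl mulr2n ltrDl.
- by rewrite ca sa ger0_norm.
- rewrite subr_ge0 (le_trans api) ?mulr_natl ?mulr2n ?lerDl ?ltW//=.
  rewrite gtrBl lt_neqAle a0 andbT eq_sym; apply/eqP => a00.
  move: sa; rewrite a00 sin0 => /esym/eqP; rewrite normr_eq0 => /eqP y00.
  by move: y0; rewrite y00 ltxx.
- have -> : 2 * pi - acos x = - acos x + pi *+ 2 by rewrite mulr_natl addrC.
  by rewrite cosD2pi sinD2pi cosN sinN ca sa ltr0_norm// opprK.
Qed.

(* Orderings of the k indices are tuples s, the j-th index met being tnth s j;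
   mod_C s is the orbit of s under the cyclic shifts. *)
Definition mod_C (k : nat) (s : k.-tuple 'I_k) : set (k.-tuple 'I_k) :=
  range (fun n : nat => [tuple of rot n s]).

(* Only meaningful for pairwise distinct points z i.  Starting the traversal
   elsewhere than at (1, 0) rotates the sorted tuple, hence gives the same
   class. *)
Definition cyclic_order (k : nat) (z : 'I_k -> circle R) :
    set (k.-tuple 'I_k) :=
  mod_C [tuple of sort (fun i j => angle (z i) <= angle (z j)) (ord_tuple k)].

End CyclicOrder.

(* (z_{a+1}, z_{b+1}, z_{c+1}, z_{d+1}) mod C_4: indices are counted from 0. *)
Definition cyc4 (a b c d : nat) : set (4.-tuple 'I_4) :=
  mod_C [tuple inord a; inord b; inord c; inord d].

(* Main.v *)
Require Import Defs.
From mathcomp Require Import all_boot all_order all_algebra.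
From mathcomp Require Import all_classical all_reals all_analysis.
From mathcomp Require Import ring lra.
Import Order.TTheory GRing.Theory Num.Theory.
Import numFieldNormedType.Exports.
Local Open Scope classical_set_scope.
Local Open Scope ring_scope.

(* Three points of the circle are never collinear, so the determinant
   [orient a b c] of three distinct points is nonzero, and it is positive
   exactly when they are met in this order counterclockwise.  The cyclic order
   of a family of points is determined by the signs of these determinants over
   all triples.  Along a family of injective maps that is continuous in t these
   signs are constant, by the intermediate value theorem.  Likewise, for a fixed
   continuous injection F of the circle, the sign of
   [orient (F a) (F b) (F c)] is the same for all counterclockwise triples,
   since any two of them are joined by a path of such triples (a segment, in
   lifted angles). *)

(** * Orientation of triples of points on the circle *)

Definition orient {R : realType} (a b c : circle R) : R :=
  ((set_val b).1 - (set_val a).1) * ((set_val c).2 - (set_val a).2) -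
  ((set_val b).2 - (set_val a).2) * ((set_val c).1 - (set_val a).1).

Lemma orient_rot {R : realType} (a b c : circle R) :
  orient a b c = orient b c a.
Proof. by rewrite /orient; ring. Qed.

Lemma orient_swap {R : realType} (a b c : circle R) :
  orient a c b = - orient a b c.
Proof. by rewrite /orient; ring. Qed.

Lemma orientaab {R : realType} (a b : circle R) : orient a a b = 0.
Proof. by rewrite /orient; ring. Qed.

Lemma orientabb {R : realType} (a b : circle R) : orient a b b = 0.
Proof. by rewrite orient_rot orientaab. Qed.

Lemma orientaba {R : realType} (a b : circle R) : orient a b a = 0.
Proof. by rewrite -orient_rot orientaab. Qed.

Lemma orient_rev {R : realType} (a b c : circle R) :
  orient c b a = - orient a b c.
Proof. by rewrite orient_swap orient_rot. Qed.

(** This is twice the signed area of an inscribed triangle. With the half-differences [p] and [q]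
    the determinant is sin 2p + sin 2q - sin 2(p + q), which factors as 4 sin p sin q sin(p + q). *)
Lemma orient_sin {R : realType} (a b c : circle R) (x y w : R) :
  set_val a = (cos x, sin x) -> set_val b = (cos y, sin y) ->
  set_val c = (cos w, sin w) ->
  orient a b c =
    4 * sin ((y - x) / 2) * sin ((w - y) / 2) * sin ((w - x) / 2).
Proof.
move=> ea eb ec; set p := (y - x) / 2; set q := (w - y) / 2.
have -> : (w - x) / 2 = p + q by rewrite /p /q; field.
have -> : orient a b c = sin (p + p) + sin (q + q) - sin (p + q + (p + q)).
  have -> : p + p = y - x by rewrite /p; field.
  have -> : q + q = w - y by rewrite /q; field.
  have -> : p + q + (p + q) = w - x by rewrite /p /q; field.
  by rewrite /orient ea eb ec !sinB /=; ring.
rewrite !(sinD, cosD).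
have cp := cos2Dsin2 p; have cq := cos2Dsin2 q.
have {}cp : cos p ^+ 2 = 1 - sin p ^+ 2 by rewrite -cp addrK.
have {}cq : cos q ^+ 2 = 1 - sin q ^+ 2 by rewrite -cq addrK.
by ring: cp cq.
Qed.

(** All three half-differences lie in ]0, pi[, so each sine is positive. Arbitrary lifts are allowed
    instead of [angle] because angles moved along a path may leave [0, 2 pi[. *)
Lemma orient_gt0_lift {R : realType} (a b c : circle R) (x y w : R) :
  set_val a = (cos x, sin x) -> set_val b = (cos y, sin y) ->
  set_val c = (cos w, sin w) -> x < y < w -> w < x + 2 * pi ->
  0 < orient a b c.
Proof.
move=> ea eb ec /andP[xy yw] wx; rewrite (orient_sin _ _ _ _ _ _ ea eb ec).
by rewrite !mulr_gt0 ?ltr0n//; apply: sin_gt0_pi; apply/andP; split; lra.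
Qed.

Lemma angle_inj {R : realType} : injective (@angle R).
Proof.
move=> a b ab; apply: val_inj.
by have [_] := angleP a; have [_] := angleP b; rewrite !set_valE ab => <-.
Qed.

Definition cyc3 {R : realType} (x y w : R) : bool :=
  [|| x < y < w, y < w < x | w < x < y].

Lemma cyc3_total {R : realType} (x y w : R) :
  x != y -> y != w -> w != x -> cyc3 x y w || cyc3 x w y.
Proof.
rewrite /cyc3 !neq_lt.
by case/orP=> ->; case/orP=> ->; case/orP=> ->; rewrite ?orbT.
Qed.

Lemma orient_gt0 {R : realType} (a b c : circle R) :
  (0 < orient a b c) = cyc3 (angle a) (angle b) (angle c).
Proof.
have lt_pos (u v w : circle R) :
    angle u < angle v < angle w -> 0 < orient u v w.
  move=> uvw; have [/andP[u0 _] eu] := angleP u.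
  have [_ ev] := angleP v; have [/andP[_ wpi] ew] := angleP w.
  by apply: orient_gt0_lift eu ev ew uvw _; lra.
have pos (u v w : circle R) :
    cyc3 (angle u) (angle v) (angle w) -> 0 < orient u v w.
  by case/or3P=> /lt_pos//; [rewrite -orient_rot | rewrite orient_rot].
(* If the triple is not in cyclic order, either two points coincide and the determinant is 0, or the
   swapped triple is in cyclic order and the determinant is negative. *)
apply/idP/idP => [|/pos//]; apply: contraTT => nabc.
have [->|ab] := eqVneq a b; first by rewrite orientaab ltxx.
have [->|bc] := eqVneq b c; first by rewrite orientabb ltxx.
have [->|ca] := eqVneq c a; first by rewrite orientaba ltxx.
have := @cyc3_total _ (angle a) (angle b) (angle c).
rewrite !(inj_eq angle_inj) (negbTE nabc) => /(_ ab bc ca)/pos.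
by rewrite (orient_swap a b c) oppr_gt0 -leNgt => /ltW.
Qed.

Lemma orient_neq0 {R : realType} (a b c : circle R) :
  a != b -> b != c -> c != a -> orient a b c != 0.
Proof.
rewrite -!(inj_eq angle_inj) => ab bc ca.
have := cyc3_total _ _ _ ab bc ca.
by rewrite -!orient_gt0 (orient_swap a b c) oppr_gt0 neq_lt orbC.
Qed.

Lemma orient_gt0_neq {R : realType} (a b c : circle R) :
  0 < orient a b c -> [/\ a != b, b != c & c != a].
Proof.
move=> abc; split; apply: contraTneq abc => ->.
- by rewrite orientaab ltxx.
- by rewrite orientabb ltxx.
- by rewrite orientaba ltxx.
Qed.

(** * Cyclic orders expressed by orientations *)

Section CyclicOrderTheory.
Context {R : realType}.

(** Cutting the circle open at [z i0] turns its cyclic order into a strict order, to which the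
    theory of sorted sequences applies. *)
Definition ccw {I : Type} (z : I -> circle R) (i0 : I) : rel I :=
  fun i j => 0 < orient (z i0) (z i) (z j).

Lemma ccw_irr {I : Type} (z : I -> circle R) i0 : irreflexive (ccw z i0).
Proof. by move=> i; rewrite /ccw orientabb ltxx. Qed.

Lemma ccw_trans {I : Type} (z : I -> circle R) i0 : transitive (ccw z i0).
Proof.
move=> j i l; rewrite /ccw !orient_gt0 /cyc3.
move: (angle _) (angle _) (angle _) (angle _) => a b c d.
by move=> /or3P[]/andP[h1 h2] /or3P[]/andP[h3 h4]; apply/or3P;
  solve [lra
   | apply: Or31; lra | apply: Or32; lra | apply: Or33; lra].
Qed.

(** The tail [t] lists the indices behind [i0] in [u], then those in front of it. For [i] behind and
    [j] in front, the angles increase along [j], [i0], [i], a rotation of the triple [i0], [i],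
    [j]. *)
Lemma pairwise_rot_ccw {I : eqType} (z : I -> circle R) (i0 : I)
    (u t : seq I) n :
  pairwise (fun i j => angle (z i) < angle (z j)) u -> rot n u = i0 :: t ->
  pairwise (ccw z i0) t.
Proof.
have head (s : seq I) :
    pairwise (fun i j => angle (z i) < angle (z j)) (i0 :: s) ->
    pairwise (ccw z i0) s.
  move=> /=/andP[i0s]; apply: (sub_in_pairwise _ i0s) => i j i0i _ ij.
  have {}i0i : angle (z i0) < angle (z i) := i0i.
  by rewrite /ccw orient_gt0 /cyc3 i0i ij.
rewrite -{1}(cat_take_drop n u) /rot.
case: (drop n u) => [|i s].
  by rewrite cats0 => + /= uE; rewrite uE => /head.
rewrite pairwise_cat => /and3P[tis tt ss] [ii0]; subst i => <-.
rewrite pairwise_cat (head _ ss) /=.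
move: tis; rewrite allrel_consr => /andP[ti0 ts].
move: ss => /=/andP[i0s _]; apply/andP; split.
  apply/allrelP => i j /(allP i0s) /= i0i /(allP ti0) /= ji0.
  by rewrite /ccw orient_gt0 /cyc3 ji0 i0i !orbT.
apply: (sub_in_pairwise _ ti0) tt => i j _ ji0 ij.
have {}ji0 : angle (z j) < angle (z i0) := ji0.
by rewrite /ccw orient_gt0 /cyc3 ji0 ij !orbT.
Qed.

Lemma mod_C_rot {k} (s u : k.-tuple 'I_k) n :
  tval s = rot n u -> mod_C s = mod_C u.
Proof.
move=> su.
have sub (x y : k.-tuple 'I_k) p : tval x = rot p y -> mod_C x `<=` mod_C y.
  move=> xy _ [q _ <-]; rewrite /mod_C /=.
  (* [rot_add_mod] composes rotations by at most the size; a larger rotation is the identity, as is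
     the rotation by the size itself. *)
  have rot_le m : exists2 m', (m' <= size y)%N &
      forall v : k.-tuple 'I_k, rot m v = rot m' v.
    case: (leqP m (size y)) => my; first by exists m.
    exists (size y) => // v; rewrite !rot_oversize ?size_tuple//.
    by move: my; rewrite size_tuple => /ltnW.
  have [p' p'y pE] := rot_le p; have [q' q'y qE] := rot_le q.
  eexists; first by [].
  by apply: val_inj => /=; rewrite qE xy pE rot_add_mod.
apply/seteqP; split; first exact: sub su.
apply: (sub _ _ (size s - n)%N).
by rewrite {2}su -{1}(rotK n u) /rotr -su.
Qed.

(** A cyclic class has exactly one representative with a given head, so it can be tested by cutting
    at [thead s]. The test involves only signs of determinants. *)
Lemma cyclic_orderP {k} (z : 'I_k.+1 -> circle R) (s : k.+1.-tuple 'I_k.+1) :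
  injective z -> uniq s ->
  cyclic_order z = mod_C s <-> pairwise (ccw z (thead s)) (behead s).
Proof.
move=> zinj su; rewrite /cyclic_order.
set u := [tuple of sort _ _].
have uu : uniq u by rewrite sort_uniq; exact: (enum_uniq 'I_k.+1).
have upw : pairwise (fun i j => angle (z i) < angle (z j)) u.
  have : pairwise (fun i j => angle (z i) <= angle (z j)) u.
    rewrite -sorted_pairwise; last by move=> j i l; apply: le_trans.
    by apply: sort_sorted => i j; apply: le_total.
  move: uu; rewrite uniq_pairwise => une ule.
  have := pairwise_relI [rel i j | i != j]
    (fun i j => angle (z i) <= angle (z j)) u.
  rewrite une ule; apply: sub_pairwise => i j /= /andP[ij].
  by rewrite lt_neqAle (inj_eq angle_inj) (inj_eq zinj) ij.
have sE : tval s = thead s :: behead s by rewrite {1}(tuple_eta s).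
have uall i : i \in u by rewrite mem_sort; exact: (mem_enum 'I_k.+1 i).
have sall i : i \in s.
  have [] := @uniq_min_size _ s (enum 'I_k.+1) su.
  - by move=> x _; rewrite mem_enum.
  - by rewrite size_enum_ord size_tuple.
  by move=> _ ->; rewrite mem_enum.
split=> [us|].
  have : mod_C s s by exists 0%N => //; apply: val_inj; rewrite /= rot0.
  rewrite -us => -[n _ /(congr1 val)/= nus].
  by apply: (pairwise_rot_ccw _ _ _ _ n upw); rewrite -sE -nus.
(* Once [u] is rotated to start at [thead s], both tails have the same elements and are sorted for
   the same strict order, hence coincide. *)
move=> spw; symmetry; apply: (mod_C_rot _ _ (index (thead s) u)).
have uE := rot_index (uall (thead s)).
rewrite uE sE; congr cons.
apply: (irr_sorted_eq (@ccw_trans _ z (thead s)) (ccw_irr _ _)).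
- exact: pairwise_sorted.
- by apply: pairwise_sorted; apply: pairwise_rot_ccw upw uE.
- have mem_tail (x : 'I_k.+1) (t : seq 'I_k.+1) : uniq (x :: t) ->
      (forall i, i \in x :: t) -> t =i predC1 x.
    move=> /=/andP[xt _] xall i; rewrite !inE; have := xall i.
    by rewrite inE; have [->|] := eqVneq i x; rewrite ?(negbTE xt).
  move=> i; rewrite (mem_tail (thead s)) -?sE// (mem_tail (thead s)) -?uE//.
    by rewrite rot_uniq.
  by move=> j; rewrite mem_rot.
Qed.
End CyclicOrderTheory.

(** * Constancy of orientation signs along continuous paths *)

Definition circle_exp {R : realType} (x : R) : circle R :=
  exist _ (cos x, sin x) (mem_set (cos2Dsin2 x)).

Lemma continuous_circle_exp {R : realType} : continuous (@circle_exp R).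
Proof.
apply: continuous_comp_initial.
move=> x; apply: (@cvg_pair _ _ _ _ (nbhs (cos x)) (nbhs (sin x))).
  exact: continuous_cos.
exact: continuous_sin.
Qed.

Lemma continuous_orient {R : realType} {T : topologicalType}
    (a b c : T -> circle R) :
  continuous a -> continuous b -> continuous c ->
  continuous (fun x => orient (a x) (b x) (c x)).
Proof.
have fst_c (h : T -> circle R) : continuous h ->
    continuous (fun x => (set_val (h x)).1).
  move=> hc x; apply: (@continuous_comp _ _ _ (set_val \o h) fst);
    last exact: cvg_fst.
  by apply: continuous_comp; [exact: hc|exact: initial_continuous].
have snd_c (h : T -> circle R) : continuous h ->
    continuous (fun x => (set_val (h x)).2).
  move=> hc x; apply: (@continuous_comp _ _ _ (set_val \o h) snd);
    last exact: cvg_snd.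
  by apply: continuous_comp; [exact: hc|exact: initial_continuous].
move=> ac bc cc x; rewrite /orient.
by apply: cvgB; apply: cvgM; apply: cvgB; (exact: fst_c || exact: snd_c).
Qed.

Lemma continuous_neq0_gt0 {R : realType} (h : R -> R) :
  {within `[0, 1], continuous h} -> (forall t, t \in `[0, 1] -> h t != 0) ->
  (0 < h 0) = (0 < h 1).
Proof.
move=> hc hn0.
have := @IVT R h 0 1 0 ler01 hc.
have := hn0 0; have := hn0 1.
rewrite !in_itv /= !lexx ler01 => /(_ isT) h1 /(_ isT) h0 ivt.
apply: contrapT => ne.
have [] := ivt; last by move=> c /hn0/eqP.
rewrite ge_min le_max; case: (ltgtP (h 0) 0) h0 ne => // _ _;
  by case: (ltgtP (h 1) 0) h1.
Qed.

Lemma continuous_inj_orient {R : realType} (F : circle R -> circle R)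
    (a b c a' b' c' : circle R) :
  continuous F -> injective F -> 0 < orient a b c -> 0 < orient a' b' c' ->
  (0 < orient (F a) (F b) (F c)) = (0 < orient (F a') (F b') (F c')).
Proof.
move=> Fc Finj.
(* The lifts increase within one turn from [x]: points met after passing (1, 0) get an extra 2
   pi. *)
have lift (p q r : circle R) : 0 < orient p q r ->
    exists x y w : R, [/\ x < y < w, w < x + 2 * pi, p = circle_exp x,
      q = circle_exp y & r = circle_exp w].
  have ang (v : circle R) : v = circle_exp (angle v).
    by apply: val_inj => /=; have [_ <-] := angleP v; rewrite set_valE.
  have per (x : R) : circle_exp (x + 2 * pi) = circle_exp x.
    by apply: val_inj => /=; rewrite mulr_natl cosD2pi sinD2pi.
  have [/andP[p0 p1] _] := angleP p.
  have [/andP[q0 q1] _] := angleP q.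
  have [/andP[r0 r1] _] := angleP r.
  rewrite orient_gt0 => /or3P[]/andP[h1 h2].
  - exists (angle p), (angle q), (angle r).
    by split; rewrite -?ang ?h1//; lra.
  - exists (angle p), (angle q + 2 * pi), (angle r + 2 * pi).
    by split; rewrite ?per -?ang//; [apply/andP; split|]; lra.
  - exists (angle p), (angle q), (angle r + 2 * pi).
    by split; rewrite ?per -?ang//; [apply/andP; split|]; lra.
move=> /lift[x [y [w [/andP[xy yw] wx -> -> ->]]]].
move=> /lift[x' [y' [w' [/andP[xy' yw'] wx' -> -> ->]]]].
pose l (p q t : R) := p + t * (q - p).
have lc p q : continuous (fun t => F (circle_exp (l p q t))).
  move=> t; apply: (@continuous_comp _ _ _ (fun t => circle_exp (l p q t)) F);
    last exact: Fc.
  apply: (@continuous_comp _ _ _ (l p q) circle_exp);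
    last exact: continuous_circle_exp.
  by apply: cvgD; [exact: cvg_cst|apply: cvgM; [exact: cvg_id|exact: cvg_cst]].
have l0 p q : l p q 0 = p by rewrite /l mul0r addr0.
have l1 p q : l p q 1 = q by rewrite /l mul1r addrC subrK.
have := @continuous_neq0_gt0 _ (fun t => orient (F (circle_exp (l x x' t)))
  (F (circle_exp (l y y' t))) (F (circle_exp (l w w' t)))).
rewrite !l0 !l1; apply.
  by apply: continuous_subspaceT; apply: continuous_orient; exact: lc.
move=> t; rewrite in_itv /= => /andP[t0 t1].
(* The gap is (1 - t)(q - p) + t(q' - p'). At t = 0 the second term vanishes and the first is
   positive; otherwise the second is positive. *)
have l_lt p p' q q' : p < q -> p' < q' -> l p p' t < l q q' t.
  rewrite /l => pq p'q'; have [->|tn0] := eqVneq t 0; first by lra.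
  have : 0 < t * (q' - p') by rewrite mulr_gt0 ?subr_gt0// lt0r tn0.
  have : 0 <= (1 - t) * (q - p) by rewrite mulr_ge0 ?subr_ge0// ltW.
  by nra.
have : 0 < orient (circle_exp (l x x' t)) (circle_exp (l y y' t))
                  (circle_exp (l w w' t)).
  apply: orient_gt0_lift; try by [].
  - by rewrite !l_lt.
  (* Interpolation commutes with the shift by 2 pi, so the triple stays within one turn. *)
  - have -> : l x x' t + 2 * pi = l (x + 2 * pi) (x' + 2 * pi) t.
      by rewrite /l; ring.
    exact: l_lt.
by move=> /orient_gt0_neq[ab bc ca]; apply: orient_neq0; rewrite (inj_eq Finj).
Qed.

(** * From signs back to cyclic orders, and the two claims *)

Lemma cyclic_order_eq {R : realType} {k} (z z' : 'I_k.+1 -> circle R) :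
  injective z -> injective z' ->
  (forall i j l, (0 < orient (z i) (z j) (z l)) =
                 (0 < orient (z' i) (z' j) (z' l))) ->
  cyclic_order z = cyclic_order z'.
Proof.
move=> zinj z'inj zz'; rewrite [RHS]/cyclic_order; set s := [tuple of _].
have su : uniq s by rewrite sort_uniq; exact: (enum_uniq 'I_k.+1).
apply/cyclic_orderP => //.
have /(cyclic_orderP _ _ z'inj su) : cyclic_order z' = mod_C s by [].
by apply: sub_pairwise => i j; rewrite /ccw zz'.
Qed.

(** After cutting at the first index, the three conditions are the pairs among the other three. *)
Lemma cyclic_order_cyc4 {R : realType} (z : 'I_4 -> circle R) (a b c d : nat) :
  injective z -> uniq [:: inord a; inord b; inord c; inord d : 'I_4] ->
  cyclic_order z = cyc4 a b c d <->
  [/\ 0 < orient (z (inord a)) (z (inord b)) (z (inord c)),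
      0 < orient (z (inord a)) (z (inord b)) (z (inord d)) &
      0 < orient (z (inord a)) (z (inord c)) (z (inord d))].
Proof.
move=> zinj su; apply: (iff_trans (cyclic_orderP _ _ zinj su)).
rewrite /thead (tnth_nth (inord a)) /= /ccw !andbT.
by split=> [/andP[/andP[-> ->] ->]|[-> -> ->]].
Qed.

Lemma uniq_inord4 (s : seq nat) :
  uniq s -> all (fun i => i < 4)%N s -> uniq [seq inord i : 'I_4 | i <- s].
Proof.
move=> su /allP s4; rewrite map_inj_in_uniq// => i j /s4 i4 /s4 j4.
by move=> /(congr1 val); rewrite /= !inordK.
Qed.

Theorem proposition3p1 (R : realType) (n : nat)
    (g : circle R -> 'rV[R]_n) (f : R -> 'rV[R]_n -> circle R)
    (hg : homeomorphism_onto_image g)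
    (hcont : forall m : circle R,
       {within `[0, 1], continuous (fun t : R => f t (g m))})
    (hinj : forall t : R, t \in `[0, 1] -> injective (f t \o g)) :
  (forall (k : nat) (m : 'I_k -> circle R), (1 <= k)%N -> injective m ->
     cyclic_order (fun i => f 0 (g (m i))) =
     cyclic_order (fun i => f 1 (g (m i))))
  /\
  (forall m : 'I_4 -> circle R, injective m ->
     cyclic_order m = cyc4 0 1 2 3 ->
     (forall t : R, t \in `[0, 1] -> homeomorphism (f t \o g) ->
        cyclic_order (fun i => f t (g (m i))) = cyc4 0 1 2 3 \/
        cyclic_order (fun i => f t (g (m i))) = cyc4 3 2 1 0)
     /\
     (cyclic_order (fun i => f 0 (g (m i))) = cyc4 0 1 3 2 ->
        ~ homeomorphism (f 1 \o g))).
Proof.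
have I0 : (0 : R) \in `[0, 1] by rewrite in_itv /= lexx ler01.
have I1 : (1 : R) \in `[0, 1] by rewrite in_itv /= lexx ler01.
have inj k (m : 'I_k -> circle R) t : t \in `[0, 1] -> injective m ->
    injective (fun i => f t (g (m i))).
  by move=> /hinj ft minj i j /ft /minj.
have part1 k (m : 'I_k -> circle R) : (1 <= k)%N -> injective m ->
    cyclic_order (fun i => f 0 (g (m i))) =
    cyclic_order (fun i => f 1 (g (m i))).
  case: k m => // k m _ minj; apply: cyclic_order_eq; [exact: inj|exact: inj|].
  move=> i j l.
  (* With a repeated index both determinants vanish; only distinct triples need the path
     argument. *)
  have [->|ij] := eqVneq i j; first by rewrite !orientaab.
  have [->|jl] := eqVneq j l; first by rewrite !orientabb.
  have [->|li] := eqVneq l i; first by rewrite !orientaba.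
  apply: (continuous_neq0_gt0 (fun t =>
    orient (f t (g (m i))) (f t (g (m j))) (f t (g (m l))))).
    by apply: continuous_orient; exact: hcont.
  by move=> t t01; apply: orient_neq0; rewrite (inj_eq (inj _ _ _ t01 minj)).
split=> // m minj mE.
have u0123 : uniq [:: inord 0; inord 1; inord 2; inord 3 : 'I_4]
  by apply: (uniq_inord4 [:: 0; 1; 2; 3]%N).
have u3210 : uniq [:: inord 3; inord 2; inord 1; inord 0 : 'I_4]
  by apply: (uniq_inord4 [:: 3; 2; 1; 0]%N).
have u0132 : uniq [:: inord 0; inord 1; inord 3; inord 2 : 'I_4]
  by apply: (uniq_inord4 [:: 0; 1; 3; 2]%N).
have /(cyclic_order_cyc4 _ _ _ _ _ minj u0123)[m012 m013 m023] := mE.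
have part2 t : t \in `[0, 1] -> homeomorphism (f t \o g) ->
    cyclic_order (fun i => f t (g (m i))) = cyc4 0 1 2 3 \/
    cyclic_order (fun i => f t (g (m i))) = cyc4 3 2 1 0.
  move=> t01 [Fc _].
  (* The reversed order is tested from index 3, which calls for this fourth triple. Seen from index
     2, point 3 precedes 0 and 0 precedes 1. *)
  have m123 : 0 < orient (m (inord 1)) (m (inord 2)) (m (inord 3)).
    have m230 : ccw m (inord 2) (inord 3) (inord 0) by rewrite /ccw -orient_rot.
    have m201 : ccw m (inord 2) (inord 0) (inord 1) by rewrite /ccw orient_rot.
    by rewrite orient_rot; exact: ccw_trans m230 m201.
  (* This records whether the map preserves or reverses orientation; [sgn] carries it to every
     counterclockwise triple. *)
  pose F012 := 0 < orient (f t (g (m (inord 0)))) (f t (g (m (inord 1))))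
                          (f t (g (m (inord 2)))).
  have sgn a b c : 0 < orient a b c ->
      (0 < orient (f t (g a)) (f t (g b)) (f t (g c))) = F012.
    by move=> abc; apply: (continuous_inj_orient _ _ _ _ _ _ _ Fc (hinj _ t01)).
  have neg a b c : 0 < orient a b c ->
      ~~ (0 < orient (f t (g a)) (f t (g b)) (f t (g c))) ->
      0 < orient (f t (g c)) (f t (g b)) (f t (g a)).
    move=> /orient_gt0_neq[ab bc ca]; rewrite -leNgt => le0.
    rewrite (orient_rev (f t (g a))) oppr_gt0 lt_neqAle le0 andbT.
    by apply: orient_neq0; rewrite (inj_eq (hinj _ t01)).
  have [F012_gt0|F012_le0] := boolP F012.
    left; apply/(cyclic_order_cyc4 _ _ _ _ _ (inj _ _ _ t01 minj) u0123).
    by rewrite !sgn.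
  right; apply/(cyclic_order_cyc4 _ _ _ _ _ (inj _ _ _ t01 minj) u3210).
  by split; apply: neg => //; rewrite sgn.
have cyc01 := cyclic_order_cyc4 _ _ _ _ _ (inj _ _ _ I0 minj).
(* Part 1 carries the order at time 1 back to time 0. There the triple (0, 3, 2) excludes the order
   0123, and (0, 1, 3) excludes 3210. *)
split=> // /(cyc01 _ _ _ _ u0132)[F013 _ F032] /(part2 _ I1).
rewrite -part1// => -[/(cyc01 _ _ _ _ u0123)[_ _]|/(cyc01 _ _ _ _ u3210)[_ _]].
  by rewrite orient_swap oppr_gt0 ltNge ltW.
by rewrite orient_rev oppr_gt0 ltNge ltW.
Qed.
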